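(* Let $n,m\ge 1$ be integers. Embed $S_{n-1}$ into $S_n$ by letting $S_{n-1}$ act on the first $n-1$ letters. Then there is an isomorphism of complex representations of $S_{n-1}\times S_m$ $$\mathrm{Res}^{S_n\times S_m}_{S_{n-1}\times S_m}\big(\mathrm{Slim}_{K_{n,m}}\big)\;\simeq_{S_{n-1}\times S_m}\;\mathrm{Park}_{K_{n,m}}.$$
   Context: $K_{n,m}$ is the complete bipartite graph whose ''righthand'' vertices are labeled $1,\dots,m$ and whose ''lefthand'' vertices are labeled $m+1,\dots,m+n$; its edges are all pairs $\{i,j\}$ with $1\le i\le m<j\le m+n$. The distinguished (root) vertex is $v=m+n$. The group $S_n\times S_m$ acts on $K_{n,m}$ by graph automorphisms, with $S_m$ permuting the vertices $1,\dots,m$ and $S_n$ permuting $m+1,\dots,m+n$; correspondingly it acts on $\mathbb{C}[x_1,\dots,x_{n+m}]$ by permuting variables. The subgroup $S_{n-1}\times S_m$ is the one fixing the root $m+n$ (so $S_{n-1}$ permutes $m+1,\dots,m+n-1$), and it acts on $\mathbb{C}[x_1,\dots,x_{n+m-1}]$ by permuting variables. $\mathrm{Park}_{K_{n,m}}$: for a nonempty set $S\subseteq\{1,\dots,n+m-1\}$ and $s\in S$, let $d_S(s)$ be the number of edges of $K_{n,m}$ joining $s$ to a vertex not in $S$ (the root $m+n$ is never in $S$). Let $\mathcal{I}_{K_{n,m}}\subseteq\mathbb{C}[x_1,\dots,x_{n+m-1}]$ be the monomial ideal generated by the monomials $m_S=\prod_{s\in S}x_s^{d_S(s)}$ over all nonempty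 $S\subseteq\{1,\dots,n+m-1\}$. Then $\mathrm{Park}_{K_{n,m}}=\mathbb{C}[x_1,\dots,x_{n+m-1}]/\mathcal{I}_{K_{n,m}}$, with the action of $S_{n-1}\times S_m$ induced by permuting variables. $\mathrm{Slim}_{K_{n,m}}$: a subgraph $H\subseteq K_{n,m}$ (a subset of the edges) is slim if its edge complement, i.e. the graph on all $n+m$ vertices whose edges are the edges of $K_{n,m}$ not in $H$, is connected. For an edge $e$ with endpoints $i<j$ set $p(e)=x_i-x_j$, and set $p(H)=\prod_{e\in H}p(e)$. Then $\mathrm{Slim}_{K_{n,m}}$ is the $\mathbb{C}$-linear span in $\mathbb{C}[x_1,\dots,x_{n+m}]$ of all $p(H)$ with $H$ slim in $K_{n,m}$; it is stable under $S_n\times S_m$ and carries the restricted action. *)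

(* Defs.v *)
From HB Require Import structures.
From mathcomp Require Import all_boot all_order all_fingroup all_algebra.
From mathcomp Require Import generic_quotient ring_quotient.
From mathcomp Require Import boolp reals.
From mathcomp Require Import complex mpoly.

Set Implicit Arguments.
Unset Strict Implicit.
Unset Printing Implicit Defensive.

Import GRing.Theory.
Local Open Scope ring_scope.
Local Open Scope quotient_scope.

(* As everywhere in MathComp, actions are right actions: (s * t) x = t (s x) for
   permutations. Accordingly msym s, the substitution 'X_i |-> 'X_(s i), is a
   right action. *)
Record representation (K : fieldType) (gT : finGroupType) := Representation {
  rep_space :> lmodType K;
  rep_act : {action gT &-> rep_space};
  rep_linear : forall g, linear (rep_act^~ g)
}.

Lemma rep_actM (K : fieldType) (gT : finGroupType) (V : representation K gT) v :
  act_morph (rep_act V) v.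
Proof.
case: (rep_act V) => to toP a b; have [_ toM] := toP.
by apply: toM; rewrite inE.
Qed.

Lemma rep_act1 (K : fieldType) (gT : finGroupType) (V : representation K gT) v :
  rep_act V v 1%g = v.
Proof.
have act_inj : left_injective (rep_act V).
  by case: (rep_act V) => to toP; have [] := toP.
by apply: (act_inj 1%g); rewrite -rep_actM mulg1.
Qed.

Definition rep_iso (K : fieldType) (gT : finGroupType)
    (V W : representation K gT) : Prop :=
  exists f : {linear V -> W},
    bijective f /\ morph_act (rep_act V) (rep_act W) f id.

Section Restriction.
Variables (K : fieldType) (gT hT : finGroupType).
Variables (f : {morphism [set: gT] >-> hT}) (V : representation K hT).

Definition res_fun (v : V) (g : gT) : V := rep_act V v (f g).

Lemma res_fun1 : res_fun^~ 1%g =1 id.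
Proof. by move=> v; rewrite /res_fun morph1 rep_act1. Qed.

Lemma res_funM v : act_morph res_fun v.
Proof. by move=> a b; rewrite /res_fun morphM ?inE // rep_actM. Qed.

Definition res_rep : representation K gT :=
  @Representation K gT V (TotalAction res_fun1 res_funM)
    (fun g => @rep_linear K hT V (f g)).
End Restriction.

Definition stable (K : fieldType) (gT : finGroupType)
    (V : representation K gT) (U : {pred V}) : Prop :=
  forall v g, v \in U -> rep_act V v g \in U.

Section Submodule.
Variables (K : fieldType) (V : lmodType K) (U : submodClosed V).

Record submod := Submod { submod_val : V; _ : submod_val \in U }.

HB.instance Definition _ := [isSub for submod_val].
HB.instance Definition _ := [Choice of submod by <:].
HB.instance Definition _ := [SubChoice_isSubLmodule of submod by <:].
End Submodule.

Section Subrepresentation.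
Variables (K : fieldType) (gT : finGroupType) (V : representation K gT).
Variables (U : submodClosed V) (stableU : stable U).

Definition sub_fun (u : submod U) (g : gT) : submod U :=
  Submod (stableU g (valP u)).

Lemma sub_fun1 : sub_fun^~ 1%g =1 id.
Proof. by move=> u; apply: val_inj; rewrite /= rep_act1. Qed.

Lemma sub_funM u : act_morph sub_fun u.
Proof. by move=> a b; apply: val_inj; rewrite /= rep_actM. Qed.

Lemma sub_fun_linear g : linear (sub_fun^~ g).
Proof. by move=> a u v; apply: val_inj; rewrite /= rep_linear. Qed.

Definition sub_rep : representation K gT :=
  @Representation K gT (submod U) (TotalAction sub_fun1 sub_funM)
    sub_fun_linear.
End Subrepresentation.

(* The abelian group underlying the quotient is the one of ring_quotient, which
   does not provide the scalar multiplication. *)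
Section QuotientModule.
Variables (K : fieldType) (V : lmodType K) (U : submodClosed V).

Definition mem_submod : {pred V} := [pred v in U].

Fact mem_submod_zmod : zmod_closed mem_submod.
Proof. exact: (GRing.submod_closedB (submodClosedP U)). Qed.
HB.instance Definition _ := GRing.isZmodClosed.Build V mem_submod
  mem_submod_zmod.

Definition quotmod : Type := Quotient.quot mem_submod.
HB.instance Definition _ := GRing.Zmodule.on quotmod.
HB.instance Definition _ := EqQuotient.on quotmod.

Definition quot_class (v : V) : quotmod := \pi_quotmod v.

Lemma quot_classP x : exists v, x = quot_class v.
Proof. by exists (repr x); rewrite /quot_class reprK. Qed.

Lemma quot_class_eqP (v w : V) : quot_class v = quot_class w <-> v - w \in U.
Proof.
rewrite -[v - w \in U]/(v - w \in mem_submod) Quotient.idealrBE.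
exact: (rwP eqP).
Qed.

Lemma repr_quot_class v : repr (quot_class v) - v \in U.
Proof. by apply/quot_class_eqP; rewrite /quot_class reprK. Qed.

Lemma quot_classD v w : quot_class (v + w) = quot_class v + quot_class w.
Proof. exact: (raddfD (\pi_(Quotient.quot mem_submod))). Qed.

Definition quot_scale (a : K) (x : quotmod) : quotmod :=
  quot_class (a *: repr x).

Lemma quot_scaleE a v : quot_scale a (quot_class v) = quot_class (a *: v).
Proof.
by apply/quot_class_eqP; rewrite -scalerBr rpredZ // repr_quot_class.
Qed.

Fact quot_scaleA a b x : quot_scale a (quot_scale b x) = quot_scale (a * b) x.
Proof. by have [v ->] := quot_classP x; rewrite !quot_scaleE scalerA. Qed.

Fact quot_scale1 : left_id 1 quot_scale.
Proof.
by move=> x; have [v ->] := quot_classP x; rewrite quot_scaleE scale1r.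
Qed.

Fact quot_scaleDr : right_distributive quot_scale +%R.
Proof.
move=> a x y; have [v ->] := quot_classP x; have [w ->] := quot_classP y.
by rewrite -quot_classD !quot_scaleE scalerDr quot_classD.
Qed.

Fact quot_scaleDl x : {morph quot_scale^~ x : a b / a + b}.
Proof.
move=> a b; have [v ->] := quot_classP x.
by rewrite !quot_scaleE scalerDl quot_classD.
Qed.

HB.instance Definition _ := GRing.Zmodule_isLmodule.Build K quotmod
  quot_scaleA quot_scale1 quot_scaleDr quot_scaleDl.

Lemma quot_classZ a v : quot_class (a *: v) = a *: quot_class v.
Proof. by rewrite -quot_scaleE. Qed.
End QuotientModule.

Section QuotientRepresentation.
Variables (K : fieldType) (gT : finGroupType) (V : representation K gT).
Variables (U : submodClosed V) (stableU : stable U).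

Definition quot_fun (x : quotmod U) (g : gT) : quotmod U :=
  quot_class U (rep_act V (repr x) g).

Lemma quot_funE v g :
  quot_fun (quot_class U v) g = quot_class U (rep_act V v g).
Proof.
have actB x y : rep_act V x g - rep_act V y g = rep_act V (x - y) g.
  by rewrite [x - y]addrC -[- y]scaleN1r rep_linear scaleN1r addrC.
by apply/quot_class_eqP; rewrite actB; apply/stableU/repr_quot_class.
Qed.

Lemma quot_fun1 : quot_fun^~ 1%g =1 id.
Proof.
by move=> x; have [v ->] := quot_classP x; rewrite quot_funE rep_act1.
Qed.

Lemma quot_funM x : act_morph quot_fun x.
Proof.
by move=> a b; have [v ->] := quot_classP x; rewrite !quot_funE rep_actM.
Qed.

Lemma quot_fun_linear g : linear (quot_fun^~ g).
Proof.
move=> a x y; have [v ->] := quot_classP x; have [w ->] := quot_classP y.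
rewrite -quot_classZ -quot_classD !quot_funE.
by rewrite rep_linear quot_classD quot_classZ.
Qed.

Definition quot_rep : representation K gT :=
  @Representation K gT (quotmod U) (TotalAction quot_fun1 quot_funM)
    quot_fun_linear.
End QuotientRepresentation.

Section Span.
Variables (K : fieldType) (V : lmodType K) (I : finType).
Variables (P : pred I) (F : I -> V).

Definition lin_span : {pred V} :=
  fun v => `[< exists c : I -> K, v = \sum_(i | P i) c i *: F i >].

Lemma lin_spanP v :
  reflect (exists c : I -> K, v = \sum_(i | P i) c i *: F i) (v \in lin_span).
Proof. exact: asboolP. Qed.

Fact lin_span_submod : submod_closed lin_span.
Proof.
split=> [|a u v /lin_spanP[c ->] /lin_spanP[d ->]]; apply/lin_spanP.
  by exists (fun=> 0); rewrite big1 // => i _; rewrite scale0r.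
exists (fun i => a * c i + d i); rewrite scaler_sumr -big_split /=.
by apply: eq_bigr => i _; rewrite scalerDl scalerA.
Qed.
HB.instance Definition _ := GRing.isSubmodClosed.Build K V lin_span
  lin_span_submod.

Lemma mem_lin_span i : P i -> F i \in lin_span.
Proof.
move=> Pi; apply/lin_spanP; exists (fun j => (j == i)%:R).
rewrite (bigD1 i) //= eqxx scale1r big1 ?addr0 // => j /andP[_ /negPf->].
by rewrite scale0r.
Qed.
End Span.

Section Ideal.
Variables (K : fieldType) (A : comAlgType K) (I : finType).
Variables (P : pred I) (F : I -> A).

Definition gen_ideal : {pred A} :=
  fun p => `[< exists q : I -> A, p = \sum_(i | P i) q i * F i >].

Lemma gen_idealP p :
  reflect (exists q : I -> A, p = \sum_(i | P i) q i * F i) (p \in gen_ideal).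
Proof. exact: asboolP. Qed.

Fact gen_ideal_submod : submod_closed gen_ideal.
Proof.
split=> [|a u v /gen_idealP[c ->] /gen_idealP[d ->]]; apply/gen_idealP.
  by exists (fun=> 0); rewrite big1 // => i _; rewrite mul0r.
exists (fun i => a *: c i + d i); rewrite scaler_sumr -big_split /=.
by apply: eq_bigr => i _; rewrite mulrDl scalerAl.
Qed.
HB.instance Definition _ := GRing.isSubmodClosed.Build K A gen_ideal
  gen_ideal_submod.

Lemma mem_gen_ideal q i : P i -> q * F i \in gen_ideal.
Proof.
move=> Pi; apply/gen_idealP; exists (fun j => if j == i then q else 0).
rewrite (bigD1 i) //= eqxx big1 ?addr0 // => j /andP[_ /negPf->].
by rewrite mul0r.
Qed.
End Ideal.

Section PolyRep.
Variables (K : fieldType) (N : nat).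

Definition poly_fun (p : {mpoly K[N]}) (s : 'S_N) := msym s p.

Lemma poly_fun1 : poly_fun^~ 1%g =1 id.
Proof. by move=> p; rewrite /poly_fun msym1m. Qed.

Lemma poly_funM p : act_morph poly_fun p.
Proof. by move=> s t; rewrite /poly_fun msymMm. Qed.

Lemma poly_fun_linear s : linear (poly_fun^~ s).
Proof. by move=> a p q; rewrite /poly_fun msymD msymZ. Qed.

Definition poly_rep : representation K 'S_N :=
  @Representation K _ {mpoly K[N]} (TotalAction poly_fun1 poly_funM)
    poly_fun_linear.
End PolyRep.

(* A graph is given by its set of edges, each edge being stored as one ordered
   pair. *)
Section Graphs.
Variable T : finType.
Implicit Type E : {set T * T}.

Definition adj E : rel T := fun u v => ((u, v) \in E) || ((v, u) \in E).

Definition gconnected E : bool := [forall u, forall v, connect (adj E) u v].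

Definition map_edges (s : {perm T}) E : {set T * T} :=
  [set (s e.1, s e.2) | e in E].

Lemma mem_map_edges (s : {perm T}) E u v :
  ((s u, s v) \in map_edges s E) = ((u, v) \in E).
Proof.
apply/imsetP/idP=> [[[u' v'] /= Euv [/perm_inj-> /perm_inj->]] //|Euv].
by exists (u, v).
Qed.

Lemma map_edges_connected (s : {perm T}) E :
  gconnected E -> gconnected (map_edges s E).
Proof.
move=> /forallP conE; apply/forallP=> u; apply/forallP=> v.
have /forallP/(_ (s^-1%g v))/connectP[p] := conE (s^-1%g u).
move: (s^-1%g u) (permKV s u) => x <-; rewrite -{2}(permKV s v).
elim: p x => [x _ -> //|y p IHp x /= /andP[xy yp] /IHp].
move/(_ yp); apply: connect_trans; apply: connect1.
by rewrite /adj !mem_map_edges.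
Qed.
End Graphs.

(* K_{n,m}: vertex number k + 1 is the ordinal k : 'I_(m + n), so the righthand
   vertices are the ordinals < m and the root is the last ordinal. An edge
   {i, j} with i < j is stored as (i, j). *)
Section CompleteBipartite.
Variables n m : nat.

Definition Kedges : {set 'I_(m + n) * 'I_(m + n)} :=
  [set e : 'I_(m + n) * 'I_(m + n) | (e.1 < m <= e.2)%N].

Definition vperm_fun (g : 'S_n * 'S_m) (i : 'I_(m + n)) : 'I_(m + n) :=
  match split i with
  | inl j => lshift n (g.2 j)
  | inr k => rshift m (g.1 k)
  end.

Lemma vperm_fun_inj g : injective (vperm_fun g).
Proof.
move=> i j; rewrite -[ i ]splitK -[ j ]splitK /vperm_fun.
case: (split i) => i'; case: (split j) => j'; rewrite !unsplitK /=.
- by move/lshift_inj/perm_inj->.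
- by move/eqP; rewrite eq_lrshift.
- by move/eqP; rewrite eq_rlshift.
- by move/rshift_inj/perm_inj->.
Qed.

Definition vperm (g : 'S_n * 'S_m) : 'S_(m + n) := perm (@vperm_fun_inj g).

Lemma vpermM : {in [set: 'S_n * 'S_m] &, {morph vperm : g h / (g * h)%g}}.
Proof.
move=> g h _ _; apply/permP=> i; rewrite permM !permE -[ i ]splitK /vperm_fun.
by case: (split i) => j; rewrite !unsplitK /= ?(unsplitK (inl _))
  ?(unsplitK (inr _)) permM.
Qed.

Definition vperm_morphism : {morphism [set: 'S_n * 'S_m] >-> 'S_(m + n)} :=
  Morphism vpermM.

Lemma vperm_ltn g i : (vperm g i < m)%N = (i < m)%N.
Proof.
rewrite permE /vperm_fun -[ i ]splitK; case: (split i) => k.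
  by rewrite unsplitK /= !ltn_ord.
by rewrite unsplitK /= !ltnNge !leq_addr.
Qed.

Lemma vperm_Kedges g i j :
  ((vperm g i, vperm g j) \in Kedges) = ((i, j) \in Kedges).
Proof. by rewrite !inE /= !(leqNgt m) !vperm_ltn. Qed.
End CompleteBipartite.

Lemma msymXi (K : fieldType) N (s : 'S_N) i :
  msym s ('X_i : {mpoly K[N]}) = 'X_(s i).
Proof.
rewrite msymX; congr 'X_[_]; apply/mnmP=> j; rewrite !mnmE.
by rewrite -(inj_eq (@perm_inj _ s)) permKV.
Qed.

Definition perm_poly_rep (K : fieldType) (n m : nat) :
    representation K ('S_n * 'S_m)%type :=
  res_rep (vperm_morphism n m) (poly_rep K (m + n)).

(* S_{n-1} in S_n, fixing the last letter; the value at n = 0 is irrelevant. *)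
Definition perm_incl (n : nat) : 'S_n.-1 -> 'S_n :=
  match n return 'S_n.-1 -> 'S_n with
  | 0 => id
  | k.+1 => lift_perm ord_max ord_max
  end.

Definition pair_incl (n m : nat) (g : 'S_n.-1 * 'S_m) : 'S_n * 'S_m :=
  (perm_incl g.1, g.2).

Lemma pair_inclM (n m : nat) :
  {in [set: 'S_n.-1 * 'S_m] &, {morph @pair_incl n m : g h / (g * h)%g}}.
Proof.
move=> [s t] [s' t'] _ _; congr pair.
by case: n s s' => //= k s s'; rewrite lift_permM.
Qed.

Definition incl_morphism (n m : nat) :
    {morphism [set: 'S_n.-1 * 'S_m] >-> ('S_n * 'S_m)%type} :=
  Morphism (@pair_inclM n m).

Section Slim.
Variables (K : fieldType) (n m : nat).
Implicit Type H : {set 'I_(m + n) * 'I_(m + n)}.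

Definition slim H : bool :=
  (H \subset Kedges n m) && gconnected (Kedges n m :\: H).

Definition subgraph_poly H : {mpoly K[m + n]} :=
  \prod_(e in H) ('X_(e.1) - 'X_(e.2)).

Definition slim_span : submodClosed (perm_poly_rep K n m) :=
  lin_span slim subgraph_poly.

Lemma subgraph_poly_sym s H :
  msym s (subgraph_poly H) = subgraph_poly (map_edges s H).
Proof.
rewrite /subgraph_poly rmorph_prod big_imset /=; last first.
  by move=> [a b] [c d] _ _ [/perm_inj-> /perm_inj->].
by apply: eq_bigr => e _; rewrite msymB !msymXi.
Qed.

Lemma slim_map_edges g H : slim H -> slim (map_edges (vperm g) H).
Proof.
case/andP=> sHK conH; apply/andP; split.
  apply/subsetP=> _ /imsetP[[i j] Hij ->]; rewrite vperm_Kedges.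
  exact: (subsetP sHK).
suff -> : Kedges n m :\: map_edges (vperm g) H =
          map_edges (vperm g) (Kedges n m :\: H) by exact: map_edges_connected.
apply/setP=> -[i j]; rewrite -[ i ](permKV (vperm g)) -[ j ](permKV (vperm g)).
by rewrite inE !mem_map_edges vperm_Kedges [RHS]inE.
Qed.

Lemma slim_span_stable : stable slim_span.
Proof.
move=> _ g /lin_spanP[c ->]; change (rep_act _ _ g) with
  (msym (vperm g) (\sum_(H | slim H) c H *: subgraph_poly H)).
rewrite raddf_sum /= rpred_sum // => H slimH; rewrite msymZ rpredZ //=.
by rewrite subgraph_poly_sym mem_lin_span // slim_map_edges.
Qed.

Definition Slim : representation K ('S_n * 'S_m)%type :=
  sub_rep slim_span_stable.
End Slim.

Section Park.
Variables (K : fieldType) (n m : nat).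
Implicit Type S : {set 'I_(m + n.-1)}.

Definition nonroot (s : 'I_(m + n.-1)) : 'I_(m + n) :=
  widen_ord (leq_add (leqnn m) (leq_pred n)) s.

Definition out_degree S (s : 'I_(m + n.-1)) : nat :=
  #|[set v | adj (Kedges n m) (nonroot s) v & v \notin nonroot @: S]|.

Definition park_monomial S : {mpoly K[m + n.-1]} :=
  \prod_(s in S) 'X_s ^+ out_degree S s.

Definition park_ideal : submodClosed (perm_poly_rep K n.-1 m) :=
  gen_ideal (fun S => S != set0) park_monomial.

Lemma nonroot_inj : injective nonroot.
Proof. by move=> i j /(congr1 val) /= /val_inj. Qed.

Lemma vperm_nonroot (g : 'S_n.-1 * 'S_m) s :
  nonroot (vperm g s) = vperm (pair_incl g) (nonroot s).
Proof.
case: g => a b; rewrite !permE /vperm_fun -[ s ]splitK.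
case: (split s) => k; rewrite unsplitK /=.
  have -> : nonroot (lshift n.-1 k) = lshift n k by apply: val_inj.
  by rewrite (unsplitK (inl k)); apply: val_inj.
pose w := widen_ord (leq_pred n).
have nonrootR k' : nonroot (rshift m k') = rshift m (w k') by apply: val_inj.
rewrite !nonrootR (unsplitK (inr _)) /=; congr rshift.
rewrite /w; case: n a k {w nonrootR s} => [|p] a k /=; first by case: k.
have -> : widen_ord (leq_pred p.+1) k = lift ord_max k.
  by apply: val_inj; apply/esym/lift_max.
by rewrite lift_perm_lift; apply: val_inj; apply/esym/lift_max.
Qed.

Lemma out_degree_perm g S s :
  out_degree (vperm g @: S) (vperm g s) = out_degree S s.
Proof.
rewrite /out_degree -[RHS](card_imset _ (@perm_inj _ (vperm (pair_incl g)))).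
apply: eq_card => v; rewrite -[v](permKV (vperm (pair_incl g))).
move: ((vperm (pair_incl g))^-1%g v) => w.
rewrite in_set mem_imset ?in_set; last exact: perm_inj.
rewrite vperm_nonroot /adj !vperm_Kedges; congr (_ && ~~ _).
apply/imsetP/imsetP=> [[_ /imsetP[t St ->]]|[t St ->]].
  by rewrite vperm_nonroot => /perm_inj->; exists t.
by exists (vperm g t); rewrite ?imset_f // vperm_nonroot.
Qed.

Lemma park_monomial_sym g S :
  msym (vperm g) (park_monomial S) = park_monomial (vperm g @: S).
Proof.
rewrite /park_monomial rmorph_prod big_imset /=; last first.
  by move=> i j _ _ /perm_inj.
by apply: eq_bigr => s _; rewrite rmorphXn /= msymXi out_degree_perm.
Qed.

Lemma park_ideal_stable : stable park_ideal.
Proof.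
move=> _ g /gen_idealP[q ->]; change (rep_act _ _ g) with
  (msym (vperm g) (\sum_(S | S != set0) q S * park_monomial S)).
rewrite raddf_sum /= rpred_sum // => S nzS; rewrite msymM park_monomial_sym.
apply: mem_gen_ideal; rewrite -!card_gt0 in nzS *.
by rewrite card_imset //; apply: perm_inj.
Qed.

Definition Park : representation K ('S_n.-1 * 'S_m)%type :=
  quot_rep park_ideal_stable.
End Park.

(* Main.v *)
From HB Require Import structures.
Require Import Defs.
From mathcomp Require Import all_boot all_order all_fingroup all_algebra.
From mathcomp Require Import boolp reals.
From mathcomp Require Import complex mpoly.

(** The isomorphism is explicit: it sends a polynomial [f] of the slim space to
    the class, modulo the parking ideal, of [f] with the root variable replaced
    by 0. It commutes with the automorphisms that fix the root, so that only its
    bijectivity is at stake, and the latter holds for every rooted multigraph.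

    After the substitution, the generator of the ideal attached to a nonempty
    vertex set [S] is the product of the [x_s^{d_S(s)}], and a monomial lies in
    the ideal when, on some nonempty [S], its exponents are at least the
    [d_S(s)]; such exponents are called unstable. A rooted multigraph is modified
    in two ways at an edge [e] that joins a vertex [i] to the root: contracting
    [e], which merges [i] into the root and kills [x_i], and deleting [e].
    Exponents follow: if [a_i = 0], then [a] is unstable exactly when it is so
    after contraction ([unstable_contract]), and [x_i x^b] is unstable exactly
    when [x^b] is so after deletion ([unstable_delete]). Both halves of the proof
    are inductions along these two operations.

    Surjectivity ([slim_spans_quotient]): contraction reaches a given polynomial
    up to unstable monomials and multiples [x_i g] of [x_i]; deletion reaches [g],
    and multiplying a slim polynomial of the graph without [e] by [x_i], the
    factor of [e] up to sign, gives a slim polynomial of the graph.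

    Injectivity ([unstable_support_eq0]) is proved on a space that contains the
    slim one: the [f] such that, for every nonempty [S], the degree in [t] of
    [f (x + t 1_S)] is less than the number of edges that leave [S]. Slim products
    satisfy this, since translating along [1_S] only affects the factors of the
    edges leaving [S], one of which is missing from a slim subgraph
    ([size_shift_slim]). If [f] in this space has only unstable monomials, then
    [f] vanishes at [x_i = 0] by contraction, hence [f = x_i g]; dividing by [x_i]
    lowers the degree in [t] by one exactly when [S] contains [i], so [g] lies in
    the space of the graph without [e], and is 0 by deletion.

    Finally, replacing the root variable by 0 is injective on the slim space,
    whose elements are polynomials in differences of variables ([root0K]). *)

Set Implicit Arguments.
Unset Strict Implicit.
Unset Printing Implicit Defensive.

Import GRing.Theory.
Local Open Scope ring_scope.

(** * Setting a variable to 0, and translations *)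

Section Polynomials.
Variables (K : fieldType) (N : nat).
Implicit Types (f g : {mpoly K[N]}) (a b m : 'X_{1..N}).
Implicit Types (i : 'I_N) (S : {set 'I_N}).

Lemma mpoly_rmorph_ext (A : nzRingType)
    (phi psi : {rmorphism {mpoly K[N]} -> A}) :
  (forall c, phi c%:MP = psi c%:MP) -> (forall i, phi 'X_i = psi 'X_i) ->
  phi =1 psi.
Proof.
move=> eqC eqX f; rewrite (mpolyE f) !rmorph_sum; apply: eq_bigr => m _.
rewrite -!mul_mpolyC !rmorphM eqC mpolyXE_id !rmorph_prod; congr (_ * _).
by apply: eq_bigr => i _; rewrite !rmorphXn eqX.
Qed.

(** The substitution of 0 for the variable of index [i]. *)
Definition subst0 i : {mpoly K[N]} -> {mpoly K[N]} :=
  mmap (@mpolyC N K) (fun j => if j == i then 0 else 'X_j).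
HB.instance Definition _ i := GRing.RMorphism.on (subst0 i).

Lemma subst0C i c : subst0 i c%:MP = c%:MP.
Proof. exact: mmapC. Qed.

Lemma subst0X i j : subst0 i 'X_j = if j == i then 0 else 'X_j.
Proof. by rewrite /subst0 mmapX mmap1U. Qed.

Lemma subst0_monomial i m : subst0 i 'X_[m] = if m i == 0%N then 'X_[m] else 0.
Proof.
rewrite mpolyXE_id rmorph_prod (bigD1 i) //= rmorphXn /= subst0X eqxx.
rewrite expr0n; case: eqP => [mi0|_]; last by rewrite mul0r.
rewrite mul1r [RHS](bigD1 i) //= mi0 expr0 mul1r; apply: eq_bigr => j ji.
by rewrite rmorphXn /= subst0X (negPf ji).
Qed.

Lemma mcoeff_subst0 i f a :
  (subst0 i f)@_a = if a i == 0%N then f@_a else 0.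
Proof.
elim/mpolyind: f => [|c m f _ _ IHf]; first by rewrite rmorph0 mcoeff0 if_same.
rewrite rmorphD -mul_mpolyC rmorphM /= subst0C subst0_monomial !mul_mpolyC.
rewrite !mcoeffD IHf; case: (eqVneq m a) => [->|ma].
  by case: eqP => _; rewrite ?scaler0 ?mcoeff0 ?add0r.
by case: (m i == 0%N); case: (a i == 0%N);
   rewrite ?mcoeffZ ?mcoeffX ?mcoeff0 ?(negPf ma) ?mulr0n ?mulr0 ?add0r.
Qed.

Lemma msupp_subst0 i f a :
  a \in msupp (subst0 i f) -> a \in msupp f /\ a i = 0%N.
Proof.
by rewrite !mcoeff_msupp mcoeff_subst0; case: (a i =P 0%N); rewrite ?eqxx.
Qed.

Lemma msupp_mulX i f b :
  (b \in msupp f) = ((U_(i) + b)%MM \in msupp ('X_i * f)).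
Proof. by rewrite !mcoeff_msupp ['X_i * f]mulrC mcoeffMX. Qed.

Lemma mulX_split i f : exists g, f = subst0 i f + 'X_i * g.
Proof.
pose h := f - subst0 i f; pose g := \sum_(m <- msupp h) h@_m *: 'X_[m - U_(i)].
exists g; apply/eqP; rewrite addrC -subr_eq -/h; apply/eqP.
rewrite {1}(mpolyE h) mulr_sumr; apply: eq_big_seq => m.
rewrite -scalerAr -mpolyXD mcoeff_msupp => mh; congr (_ *: 'X_[_]).
rewrite addmC submK //; apply/mnm_lepP=> j; rewrite mnm1E.
case: eqP => // <-; rewrite lt0n; apply: contraNneq mh => mi0.
by rewrite /h mcoeffB mcoeff_subst0 mi0 eqxx subrr.
Qed.

Lemma msupp_mulX_split i f g b : f = subst0 i f + 'X_i * g ->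
  b \in msupp g -> (U_(i) + b)%MM \in msupp f.
Proof.
move=> fE; rewrite (msupp_mulX i) !mcoeff_msupp => nz.
rewrite fE mcoeffD mcoeff_subst0 mnmDE mnm1E eqxx add1n add0r.
exact: nz.
Qed.

(** [f (x + t 1_S)] as a polynomial in [t], represented by ['X], whose
    coefficients are polynomials in [x]. *)
Definition shift S : {mpoly K[N]} -> {poly {mpoly K[N]}} :=
  mmap (polyC \o @mpolyC N K) (fun i => ('X_i)%:P + (i \in S)%:R *: 'X).
HB.instance Definition _ S := GRing.RMorphism.on (shift S).

Lemma shiftC S c : shift S c%:MP = (c%:MP)%:P.
Proof. exact: mmapC. Qed.

Lemma shiftX S i : shift S 'X_i = ('X_i)%:P + (i \in S)%:R *: 'X.
Proof. by rewrite /shift mmapX mmap1U. Qed.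

Lemma shift_horner0 S f : (shift S f).[0] = f.
Proof.
have horner0 : forall p : {poly {mpoly K[N]}}, horner_eval 0 p = p.[0] by [].
rewrite -horner0 -[LHS]/((horner_eval 0 \o shift S) f) -[RHS]/(idfun f).
move: f; apply: mpoly_rmorph_ext => [c|i] /=.
  by rewrite horner0 shiftC hornerC.
by rewrite horner0 shiftX hornerD hornerC hornerZ hornerX mulr0 addr0.
Qed.

Lemma shift_inj S : injective (shift S).
Proof.
by move=> f g eq_fg; rewrite -(shift_horner0 S f) eq_fg shift_horner0.
Qed.

Lemma shift_subst0 S i f : i \notin S ->
  shift S (subst0 i f) = map_poly (subst0 i) (shift S f).
Proof.
move=> iS; rewrite -[LHS]/((shift S \o subst0 i) f).
rewrite -[RHS]/((map_poly (subst0 i) \o shift S) f).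
move: f; apply: mpoly_rmorph_ext => [c|j] /=.
  by rewrite subst0C shiftC map_polyC /= subst0C.
rewrite shiftX rmorphD /= map_polyC map_polyZ map_polyX /= rmorph_nat subst0X.
case: (eqVneq j i) => [->|ji]; last by rewrite shiftX.
by rewrite (negPf iS) rmorph0 scale0r addr0.
Qed.

Lemma size_shift_subst0 S i f : i \notin S ->
  (size (shift S (subst0 i f)) <= size (shift S f))%N.
Proof. by move=> iS; rewrite shift_subst0 //; apply: size_poly. Qed.

Lemma size_shift_mulX S i f : f != 0 ->
  size (shift S ('X_i * f)) = ((i \in S) + size (shift S f))%N.
Proof.
move=> nzf; rewrite rmorphM /= shiftX.
have nzs : shift S f != 0.
  by rewrite -(rmorph0 (shift S)) (inj_eq (@shift_inj S)).
have nzX : 'X_i != 0 :> {mpoly K[N]} by rewrite -msupp_eq0 msuppX.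
case: (i \in S); last by rewrite scale0r addr0 mul_polyC size_scale.
rewrite scale1r addrC -['X_i]opprK polyCN.
by rewrite size_mul ?polyXsubC_eq0 // size_XsubC.
Qed.
End Polynomials.

(** * Polynomials with all exponents in a given set *)

Section Supports.
Variables (K : fieldType) (N : nat).
Implicit Types (f g : {mpoly K[N]}) (P Q : 'X_{1..N} -> Prop).

(** All exponents of monomials of [f] satisfy [P]. When [P a] implies [P (b + a)]
    for all [b], these [f] form a monomial ideal. *)
Definition supported P f := forall a, a \in msupp f -> P a.

Lemma supported0 P : supported P (0 : {mpoly K[N]}).
Proof. by move=> a; rewrite msupp0. Qed.

Lemma supportedD P f g : supported P f -> supported P g -> supported P (f + g).
Proof.
by move=> Pf Pg a /msuppD_le; rewrite mem_cat => /orP[/Pf|/Pg].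
Qed.

Lemma supportedN P f : supported P f -> supported P (- f).
Proof. by move=> Pf a; rewrite (perm_mem (msuppN f)) => /Pf. Qed.

Lemma supportedB P f g : supported P f -> supported P g -> supported P (f - g).
Proof. by move=> Pf /supportedN; apply: supportedD. Qed.

Lemma supportedM P f g : (forall a b, P a -> P (b + a)%MM) ->
  supported P f -> supported P (g * f).
Proof.
move=> upP Pf _ /msuppM_le/allpairsP[[b a] /= [_ /Pf Pa ->]]; exact: upP.
Qed.

Lemma supported_sum (J : finType) (Q : pred J) P (F : J -> {mpoly K[N]}) :
  (forall j, Q j -> supported P (F j)) -> supported P (\sum_(j | Q j) F j).
Proof.
move=> PF; elim/big_ind: _ => //; [exact: supported0 | exact: supportedD].
Qed.

Lemma supportedX P a : P a -> supported P ('X_[a] : {mpoly K[N]}).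
Proof. by move=> Pa b; rewrite msuppX inE => /eqP->. Qed.

Lemma supported_mulX P Q i f : (forall a, Q a -> P (U_(i) + a)%MM) ->
  supported Q f -> supported P ('X_i * f).
Proof.
move=> QP Qf a; rewrite mulrC (perm_mem (msuppMX f U_(i)%MM)).
by case/mapP=> b /Qf/QP ? ->.
Qed.
End Supports.

(** * Slim polynomials and unstable exponents of a rooted multigraph *)

(** The edges form the finite type [I]; the ends of an edge are [None], the root,
    or [Some i] with [i] a vertex other than the root. Contractions and deletions
    are recorded by a pair [U], [A]: [A] is the set of edges that remain, and [U]
    that of the vertices that are not merged into the root. *)
Section RootedMultigraph.
Variables (K : fieldType) (N : nat) (I : finType).
Variables (src tgt : I -> option 'I_N).
Implicit Types (U S : {set 'I_N}) (A H : {set I}) (e : I) (i s : 'I_N).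
Implicit Types (a b : 'X_{1..N}) (f g : {mpoly K[N]}).

Definition inside S (o : option 'I_N) := if o is Some i then i \in S else false.
(** Exactly one end of [e] lies in [S]. *)
Definition crosses S e := inside S (src e) (+) inside S (tgt e).
Definition incident s e := (src e == Some s) || (tgt e == Some s).
Definition cut A S := [set e in A | crosses S e].
(** The number of edges of [A] that join [s] to a vertex outside [S], provided
    that [s] is in [S]. *)
Definition cut_degree A S s := #|[set e in cut A S | incident s e]|.

(** The exponents of the monomials in the ideal generated by the variables outside
    [U] and by the parking generators of the nonempty subsets of [U]. *)
Definition unstable U A a : Prop :=
  (exists2 v, v \notin U & (0 < a v)%N) \/
  (exists S, [/\ S != set0, S \subset U &
     forall s, s \in S -> (cut_degree A S s <= a s)%N]).

(** [H] is contained in [A], and [A :\: H] is connected once the vertices outside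
    [U] are merged into the root. Connectedness is expressed by cuts: some edge of
    [A :\: H] leaves each nonempty subset of [U]. *)
Definition slim_in U A H : bool :=
  (H \subset A) && [forall S : {set 'I_N}, (S != set0) && (S \subset U) ==>
                     [exists e in A :\: H, crosses S e]].

(** The variable of a vertex, which is 0 at the root. *)
Definition end_var (o : option 'I_N) : {mpoly K[N]} :=
  if o is Some i then 'X_i else 0.
Definition edge_poly e := end_var (src e) - end_var (tgt e).
Definition edge_prod H : {mpoly K[N]} := \prod_(e in H) edge_poly e.

(** [e] joins the vertex [i] of [U] to the root or to a vertex outside [U]. *)
Definition links U i e : Prop := i \in U /\
  exists2 o, ~~ inside U o &
    (src e = Some i /\ tgt e = o) \/ (src e = o /\ tgt e = Some i).

Lemma links_of_crosses U e : crosses U e -> exists i, links U i e.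
Proof.
rewrite /crosses; case Us: (inside U (src e));
  case Ut: (inside U (tgt e)) => // _.
  case s_e: (src e) Us => [i|] //= Ui; exists i; split=> //.
  by exists (tgt e); rewrite ?Ut //; left.
case t_e: (tgt e) Ut => [i|] //= Ui; exists i; split=> //.
by exists (src e); rewrite ?Us //; right.
Qed.

Lemma inside_sub U S o : S \subset U -> ~~ inside U o -> inside S o = false.
Proof. by case: o => //= i /subsetP sSU; apply/contraNF/sSU. Qed.

Lemma crosses_links U S i e :
  links U i e -> S \subset U -> crosses S e = (i \in S).
Proof.
case=> _ [o /(@inside_sub U S)oS ends] sSU; move/(_ sSU) in oS.
by rewrite /crosses; case: ends => -[-> ->]; rewrite /= oS ?addbF.
Qed.

Lemma incident_links U s i e :
  links U i e -> s \in U -> incident s e = (s == i).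
Proof.
case=> _ [o oU ends] Us; have oNs : (o == Some s) = false.
  by apply: contraNF oU => /eqP->.
by rewrite /incident; case: ends => -[-> ->]; rewrite oNs ?orbF -[LHS]eq_sym.
Qed.

Lemma card_cut_links U S i e A : links U i e -> S \subset U -> e \in A ->
  #|cut A S| = ((i \in S) + #|cut (A :\ e) S|)%N.
Proof.
move=> lk sSU Ae; rewrite (cardsD1 e) inE Ae (crosses_links lk) //=.
by congr (_ + #|pred_of_set _|)%N; apply/setP=> e'; rewrite !inE andbA.
Qed.

Lemma cut_degree_links U S i e A s : links U i e -> S \subset U -> e \in A ->
  s \in S -> cut_degree A S s = ((i == s) + cut_degree (A :\ e) S s)%N.
Proof.
move=> lk sSU Ae Ss; rewrite /cut_degree (cardsD1 e) !inE Ae.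
rewrite (crosses_links lk) //=.
rewrite (incident_links lk) ?(subsetP sSU) //; congr addn.
  by rewrite [i == s]eq_sym; case: eqP => [<-|]; rewrite ?Ss ?andbF.
by apply: eq_card => e'; rewrite !inE !andbA.
Qed.

Lemma unstable_up U A a b : unstable U A a -> unstable U A (b + a)%MM.
Proof.
case=> [[v Uv av]|[S [nzS sSU leS]]].
  by left; exists v; rewrite // mnmDE addn_gt0 av orbT.
right; exists S; split=> // s /leS/leq_trans; apply.
by rewrite mnmDE leq_addl.
Qed.

Lemma unstable_contract U A i e a : links U i e -> e \in A -> a i = 0%N ->
  unstable (U :\ i) A a <-> unstable U A a.
Proof.
move=> lk Ae ai0; split=> -[[v Uv av]|[S [nzS sSU leS]]].
- left; exists v => //; move: Uv.
  rewrite !inE negb_and negbK => /orP[/eqP vi|//].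
  by rewrite vi ai0 in av.
- right; exists S; split=> //.
  by move: sSU; rewrite subsetD1 => /andP[].
- by left; exists v; rewrite // !inE negb_and Uv orbT.
- right; exists S; split=> //; rewrite subsetD1 sSU; apply/negP=> Si.
  by have := leS i Si; rewrite (cut_degree_links lk) // eqxx ai0.
Qed.

Lemma unstable_delete U A i e b : links U i e -> e \in A ->
  unstable U A (U_(i) + b)%MM <-> unstable U (A :\ e) b.
Proof.
move=> lk Ae; split=> -[[v Uv av]|[S [nzS sSU leS]]].
- left; exists v => //; move: av; rewrite mnmDE mnm1E; case: eqP => // iv.
  by case: lk Uv => Ui _; rewrite -iv Ui.
- right; exists S; split=> // s Ss; have := leS s Ss.
  by rewrite (cut_degree_links lk) // mnmDE mnm1E leq_add2l.
- by left; exists v; rewrite // mnmDE addn_gt0 av orbT.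
- right; exists S; split=> // s Ss.
  by rewrite (cut_degree_links lk) // mnmDE mnm1E leq_add2l leS.
Qed.

Lemma slim_inP U A H :
  reflect (H \subset A /\ forall S, S != set0 -> S \subset U ->
             exists2 e, e \in A :\: H & crosses S e) (slim_in U A H).
Proof.
apply: (iffP andP) => -[sHA cutS]; split=> //.
  move=> S nzS sSU; have /forallP/(_ S) := cutS.
  by rewrite nzS sSU => /exists_inP.
by apply/forallP=> S; apply/implyP=> /andP[nzS sSU]; apply/exists_inP/cutS.
Qed.

Lemma slim_in_contract U A H i e : links U i e -> e \in A -> e \notin H ->
  slim_in (U :\ i) A H -> slim_in U A H.
Proof.
move=> lk Ae He /slim_inP[sHA cutS]; apply/slim_inP; split=> // S nzS sSU.
have [Si|Si] := boolP (i \in S).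
  by exists e; rewrite ?inE ?He // (crosses_links lk).
by apply: cutS; rewrite // subsetD1 sSU.
Qed.

Lemma slim_in_delete U A H e : e \in A ->
  slim_in U (A :\ e) H -> slim_in U A (e |: H).
Proof.
move=> Ae /slim_inP[sHA cutS]; apply/slim_inP; split.
  by rewrite subUset sub1set Ae (subset_trans sHA) ?subD1set.
by move=> S nzS sSU; rewrite -setDDl; apply: cutS.
Qed.

Lemma edge_poly_links U i e : links U i e ->
  exists o (c : bool), ~~ inside U o /\
    edge_poly e = (-1) ^+ c * ('X_i - end_var o).
Proof.
case=> _ [o oU [[si to]|[so ti]]]; exists o.
  by exists false; split=> //; rewrite /edge_poly si to expr0 mul1r.
by exists true; split=> //; rewrite /edge_poly so ti expr1 mulN1r opprB.
Qed.

Lemma supported_end_var U A o : ~~ inside U o ->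
  supported (unstable U A) (end_var o).
Proof.
case: o => [v|] /= Uv; last exact: supported0.
by apply: supportedX; left; exists v; rewrite // mnm1E eqxx.
Qed.

(** The slim products of the contracted graph that involve [e] lie in the ideal of
    that graph, since both ends of [e] have been merged into the root; the others
    are slim before contraction. *)
Lemma lin_span_contract U A i e (p : {mpoly K[N]}) : links U i e -> e \in A ->
  p \in lin_span (slim_in (U :\ i) A) edge_prod ->
  exists2 p', p' \in lin_span (slim_in U A) edge_prod &
    supported (unstable (U :\ i) A) (p - p').
Proof.
move=> lk Ae /lin_spanP[c ->].
rewrite (bigID (fun H => e \in H)) /=.
set s1 := (X in X + _); set s2 := (X in _ + X).
exists s2; last first.
  rewrite addrK; apply: supported_sum => H /andP[_ He].
  rewrite -mul_mpolyC /edge_prod (bigD1 e) //= mulrCA mulrC.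
  apply: supportedM; first by move=> a b; apply: unstable_up.
  have [o [b [oU ->]]] := edge_poly_links lk.
  apply: supportedM; first by move=> a ?; apply: unstable_up.
  apply: supportedB.
    by apply: (@supported_end_var _ _ (Some i)); rewrite /= !inE eqxx.
  apply: supported_end_var; apply: contra oU.
  by case: o => //= v; rewrite !inE => /andP[].
apply: rpred_sum => H /andP[slH He]; rewrite rpredZ //.
by apply: mem_lin_span; apply: (slim_in_contract lk Ae He slH).
Qed.

Lemma lin_span_delete U A e (p : {mpoly K[N]}) : e \in A ->
  p \in lin_span (slim_in U (A :\ e)) edge_prod ->
  edge_poly e * p \in lin_span (slim_in U A) edge_prod.
Proof.
move=> Ae /lin_spanP[c ->]; rewrite mulr_sumr rpred_sum // => H slH.
rewrite -scalerAr rpredZ //.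
have eH : e \notin H.
  have /slim_inP[/subsetP sHA _] := slH.
  by apply/negP=> /sHA; rewrite !inE eqxx.
rewrite [_ * _](_ : _ = edge_prod (e |: H)); last first.
  by rewrite /edge_prod big_setU1.
by apply: mem_lin_span; apply: slim_in_delete.
Qed.

(** Slim products span the polynomials modulo the monomials with unstable
    exponents. *)
Lemma slim_spans_quotient U A q : exists2 s,
  s \in lin_span (slim_in U A) edge_prod & supported (unstable U A) (q - s).
Proof.
have [n] := ubnP (#|U| + #|A|)%N; elim: n U A q => [|n IHn] U A q le_n //.
have [cut0|[e]] := set_0Vmem (cut A U); last first.
  rewrite inE => /andP[Ae /links_of_crosses[i lk]].
  have lt1 : (#|U :\ i| + #|A| < n)%N.
    by move: le_n; rewrite (cardsD1 i U) lk.1.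
  have lt2 : (#|U| + #|A :\ e| < n)%N.
    by move: le_n; rewrite (cardsD1 e A) Ae addnCA.
  have [s1 s1P q_s1] := IHn _ _ q lt1.
  have [s2 s2P s1_s2] := lin_span_contract lk Ae s1P.
  pose r := q - s2; have [g rE] := mulX_split i r.
  have rU : supported (unstable (U :\ i) A) r.
    by rewrite /r -(subrK s1 q) -addrA; apply: supportedD.
  have [s3 s3P g_s3] := IHn _ _ g lt2.
  have [o [c [oU eE]]] := edge_poly_links lk.
  exists (s2 + (-1) ^+ c *: (edge_poly e * s3)).
    by rewrite rpredD // rpredZ // lin_span_delete.
  (* [o] is the other end of [e], whose variable generates unstable monomials. *)
  have -> : q - (s2 + (-1) ^+ c *: (edge_poly e * s3)) =
      subst0 i r + 'X_i * (g - s3) + s3 * end_var o.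
    rewrite opprD addrA -/r {1}rE eE -mul_mpolyC rmorphXn rmorphN1 !mulrA.
    rewrite -exprMn mulrNN mulr1 expr1n mul1r mulrBl mulrBr.
    by rewrite opprB [s3 * _]mulrC !addrA addrAC.
  apply: supportedD; first apply: supportedD.
  - move=> a /msupp_subst0[/rU ar ai0]; exact/(unstable_contract lk Ae ai0).
  - by apply: supported_mulX g_s3 => b /(unstable_delete b lk Ae).
  - apply: supportedM; first by move=> a b; apply: unstable_up.
    exact: supported_end_var.
(* No edge leaves U: either U is empty and constants suffice, or every exponent
   is unstable. *)
have [U0|nzU] := eqVneq U set0.
  exists (q@_0 *: edge_prod set0).
    rewrite rpredZ // mem_lin_span //; apply/slim_inP.
    by split=> [|S nzS]; rewrite ?sub0set // U0 subset0 (negPf nzS).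
  move=> a; rewrite /edge_prod big_set0 mcoeff_msupp mcoeffB mcoeffZ mcoeff1.
  move=> nz; left; have /eqP/mnmP : a != 0%MM.
    by apply: contraNneq nz => ->; rewrite eqxx mulr1 subrr.
  have [/forallP a0 []|] := boolP [forall v, a v == 0%N].
    by move=> v; rewrite mnm0E; exact/eqP.
  rewrite negb_forall => /existsP[v av] _.
  by exists v; rewrite ?U0 ?inE // lt0n.
exists 0; first exact: rpred0.
move=> a _; right; exists U; split=> // s _.
by rewrite /cut_degree cut0 (eq_card0 (A := _)) // => e; rewrite !inE.
Qed.

(** A polynomial in the variables of [U], all of whose exponents are unstable, is
    0 if, for all nonempty subsets [S] of [U], its degree along [1_S] is less than
    the number of edges of [A] that leave [S]. *)
Lemma unstable_support_eq0 U A f :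
  supported (fun a => forall v, v \notin U -> a v = 0%N) f ->
  (forall S, S != set0 -> S \subset U -> (size (shift S f) <= #|cut A S|)%N) ->
  supported (unstable U A) f -> f = 0.
Proof.
have [n] := ubnP (#|U| + #|A|)%N; elim: n U A f => [|n IHn] U A f le_n //.
move=> varsU size_f unst_f.
have [cut0|[e]] := set_0Vmem (cut A U); last first.
  rewrite inE => /andP[Ae /links_of_crosses[i lk]].
  have lt1 : (#|U :\ i| + #|A| < n)%N.
    by move: le_n; rewrite (cardsD1 i U) lk.1.
  have lt2 : (#|U| + #|A :\ e| < n)%N.
    by move: le_n; rewrite (cardsD1 e A) Ae addnCA.
  have f0 : subst0 i f = 0.
    apply: (IHn (U :\ i) A) => //.
    - move=> a /msupp_subst0[/varsU aU ai0] v.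
      by rewrite !inE negb_and negbK => /orP[/eqP->|/aU].
    - move=> S nzS; rewrite subsetD1 => /andP[sSU iS].
      exact: leq_trans (size_shift_subst0 _ iS) (size_f S nzS sSU).
    - move=> a /msupp_subst0[/unst_f af ai0].
      exact/(unstable_contract lk Ae ai0).
  have [g fE] := mulX_split i f.
  have supp_g b : b \in msupp g -> (U_(i) + b)%MM \in msupp f.
    exact: msupp_mulX_split fE.
  move: fE; rewrite f0 add0r => fE.
  have [g0|nzg] := eqVneq g 0; first by rewrite fE g0 mulr0.
  rewrite fE (IHn U (A :\ e) g) ?mulr0 //.
  - move=> b /supp_g/varsU bU v Uv; have /eqP := bU v Uv.
    by rewrite mnmDE addn_eq0 => /andP[_ /eqP].
  - move=> S nzS sSU.
    rewrite -(leq_add2l (i \in S)) -(size_shift_mulX S i nzg) -fE.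
    by rewrite -(card_cut_links lk sSU Ae) size_f.
  - by move=> b /supp_g/unst_f/(unstable_delete _ lk Ae).
(* No edge leaves U: if U is not empty, the degree along 1_U is less than 0. *)
have [U0|nzU] := eqVneq U set0; last first.
  apply: (@shift_inj _ _ U); rewrite rmorph0; apply/eqP.
  by rewrite -size_poly_leq0 (leq_trans (size_f U _ _)) // cut0 cards0.
apply/eqP; rewrite -msupp_eq0; case f_a: (msupp f) => [//|a t].
have fa : a \in msupp f by rewrite f_a inE eqxx.
case: (unst_f a fa) => [[v Uv]|[S [nzS]]]; first by rewrite (varsU a fa v Uv).
by rewrite U0 subset0 (negPf nzS).
Qed.

Lemma size_shift_edge_poly S e :
  (size (shift S (edge_poly e)) <= (crosses S e).+1)%N.
Proof.
have shift_end o : shift S (end_var o) = (end_var o)%:P + (inside S o)%:R *: 'X.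
  by case: o => [i|] /=; rewrite ?shiftX // !rmorph0 scale0r addr0.
rewrite rmorphB /= !shift_end opprD addrACA -scalerBl -polyCB /crosses.
set c := (_ - _)%:P; have size_c : (size c <= 1)%N by exact: size_polyC_leq1.
case: (inside S (src e)); case: (inside S (tgt e)) => /=;
  rewrite ?subrr ?scale0r ?addr0 ?(leq_trans size_c) //.
all: apply: (leq_trans (size_polyD _ _)).
all: rewrite geq_max (leq_trans size_c) //=.
all: by rewrite (leq_trans (size_scale_leq _ _)) // size_polyX.
Qed.

Lemma size_shift_edge_prod S H :
  (size (shift S (edge_prod H)) <= #|cut H S|.+1)%N.
Proof.
have -> : #|cut H S| = (\sum_(e in H) crosses S e)%N.
  rewrite -sum1_card (eq_bigl _ _ (in_set _)) big_mkcondr.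
  by apply: eq_bigr => e _; case: crosses.
rewrite rmorph_prod /=; elim/big_rec2: _ => [|e n p _ IH].
  by rewrite size_poly1.
apply: (leq_trans (size_polyMleq _ _)).
rewrite -subn1 leq_subLR add1n -addnS -addSn.
exact: leq_add (size_shift_edge_poly S e) IH.
Qed.

Lemma size_shift_slim U A S p : S != set0 -> S \subset U ->
  p \in lin_span (slim_in U A) edge_prod -> (size (shift S p) <= #|cut A S|)%N.
Proof.
move=> nzS sSU /lin_spanP[c ->]; rewrite rmorph_sum /=.
elim/big_ind: _ => [|p1 p2 h1 h2|H slH]; first by rewrite size_poly0.
  by apply: (leq_trans (size_polyD _ _)); rewrite geq_max h1.
rewrite -mul_mpolyC rmorphM /= shiftC mul_polyC.
apply: (leq_trans (size_scale_leq _ _)).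
apply: (leq_trans (size_shift_edge_prod _ _)).
have /slim_inP[sHA /(_ S nzS sSU)[e]] := slH.
rewrite inE => /andP[He Ae] cSe; apply/proper_card/properP; split.
  by apply/subsetP=> e'; rewrite !inE => /andP[/(subsetP sHA)->].
by exists e; rewrite !inE ?Ae // (negPf He).
Qed.

End RootedMultigraph.

(** * The complete bipartite graph *)

Section CompleteBipartite.
Variables (K : fieldType) (n m : nat).
Hypothesis n_gt0 : (0 < n)%N.
Local Notation N := (m + n.-1)%N.
Local Notation vertex := 'I_(m + n).
Local Notation edge := (vertex * vertex)%type.
Local Notation nonroot := (@nonroot n m).
Local Notation Kedges := (Kedges n m).
Implicit Types (v w : vertex) (s : 'I_N) (S : {set 'I_N}) (H : {set edge}).
Implicit Types (f : {mpoly K[N]}) (p : {mpoly K[m + n]}).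

(** The index of the variable of a vertex: [None] for the root, which is the last
    vertex. *)
Definition label v : option 'I_N := insub (val v).

Lemma label_nonroot s : label (nonroot s) = Some s.
Proof. by rewrite /label; exact: valK. Qed.

Lemma label_Some v s : label v = Some s -> v = nonroot s.
Proof.
rewrite /label; case: insubP => // s' _ vs' [<-].
by apply: val_inj; exact: esym.
Qed.

Lemma label_inj : injective label.
Proof.
move=> v w; case lv: (label v) => [s|] lw.
  by rewrite (label_Some lv) (label_Some (esym lw)).
have vroot u : label u = None -> val u = N.
  rewrite /label; case: insubP => // u_ge _; apply/eqP.
  rewrite eqn_leq andbC leqNgt u_ge /=.
  by rewrite -ltnS -addnS prednK ?ltn_ord.
by apply: val_inj; rewrite (vroot v lv) (vroot w (esym lw)).
Qed.

Lemma root_exists : exists v0, label v0 = None.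
Proof.
have lt_root : (N < m + n)%N by rewrite ltn_add2l prednK.
by exists (Ordinal lt_root); rewrite /label insubF //= ltnn.
Qed.

Definition edge_src (e : edge) := label e.1.
Definition edge_tgt (e : edge) := label e.2.

Lemma mem_nonroot S v : (v \in nonroot @: S) = inside S (label v).
Proof.
case lv: (label v) => [s|] /=.
  by rewrite (label_Some lv) mem_imset //; exact: nonroot_inj.
by apply/negbTE/imsetP => -[s _ vE]; rewrite vE label_nonroot in lv.
Qed.

(** The complement of [H] is connected exactly when it has, for each nonempty set
    of vertices other than the root, an edge that leaves this set. *)
Lemma slim_cutE H : slim H = slim_in edge_src edge_tgt setT Kedges H.
Proof.
rewrite /slim /slim_in; apply: andb_id2l => _; have [v0 lv0] := root_exists.
have adj_sym : ssrbool.symmetric (adj (Kedges :\: H)).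
  by move=> u v; rewrite /adj orbC.
have con_sym := sym_connect_sym adj_sym.
apply/idP/idP=> [/forallP con|cutS].
  apply/forallP=> S; apply/implyP=> /andP[/set0Pn[s Ss] _]; apply/exists_inP.
  apply: contrapT => no_e.
  (* With no edge leaving S, the component of s would avoid the root. *)
  have cl : closed (adj (Kedges :\: H)) [pred v | inside S (label v)].
    have side u v : (u, v) \in Kedges :\: H ->
        inside S (label u) = inside S (label v).
      move=> uv; apply/eqP/negPn/negP => neq; apply: no_e; exists (u, v) => //.
      by rewrite /crosses /edge_src /edge_tgt /= -negb_eqb.
    by move=> u v /orP[/side|/side/esym].
  have /forallP/(_ v0)/(closed_connect cl) := con (nonroot s).
  by rewrite !inE label_nonroot lv0 /= Ss.
(* S is the set of the vertices that are not connected to the root. *)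
pose S := [set s | ~~ connect (adj (Kedges :\: H)) v0 (nonroot s)].
have S0 : S = set0.
  apply/eqP/negPn/negP=> nzS; have /forallP/(_ S) := cutS.
  rewrite nzS subsetT /= => /exists_inP[[u v] uv].
  have con_out w : ~~ inside S (label w) -> connect (adj (Kedges :\: H)) v0 w.
    case lw: (label w) => [s|] /=; first by rewrite inE negbK -(label_Some lw).
    by move=> _; rewrite (label_inj (etrans lw (esym lv0))) connect0.
  have con_in w : inside S (label w) -> ~~ connect (adj (Kedges :\: H)) v0 w.
    by case lw: (label w) => [s|] //=; rewrite inE -(label_Some lw).
  have a_uv : connect (adj (Kedges :\: H)) u v.
    by apply: connect1; rewrite /adj uv.
  have a_vu : connect (adj (Kedges :\: H)) v u by rewrite con_sym.
  rewrite /crosses /edge_src /edge_tgt /=; case Su: (inside S (label u));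
    case Sv: (inside S (label v)) => // _.
    by have := con_in u Su; rewrite (connect_trans (con_out v _) a_vu) ?Sv.
  by have := con_in v Sv; rewrite (connect_trans (con_out u _) a_uv) ?Su.
have con0 v : connect (adj (Kedges :\: H)) v0 v.
  case lv: (label v) => [s|]; last first.
    by rewrite (label_inj (etrans lv (esym lv0))) connect0.
  have : s \notin S by rewrite S0 inE.
  by rewrite inE negbK -(label_Some lv).
apply/forallP=> u; apply/forallP=> v; apply: connect_trans (con0 v).
by rewrite con_sym.
Qed.

Lemma cut_degree_Kedges S s : s \in S ->
  cut_degree edge_src edge_tgt Kedges S s = out_degree S s.
Proof.
(* F v is the edge between s and v: the vertex numbered below m comes first. *)
move=> Ss; pose F v := if (s < m)%N then (nonroot s, v) else (v, nonroot s).
have F_inj : injective F by rewrite /F => v w; case: (s < m)%N => -[].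
rewrite /out_degree -(card_imset _ F_inj) /cut_degree.
apply: eq_card => -[u v]; rewrite !inE /=; apply/idP/imsetP; last first.
  case=> w; rewrite !inE mem_nonroot /adj !inE /= /F.
  case: (ltnP s m) => s_m; rewrite ?andbF ?andbT ?orbF /=;
    move=> /andP[mw Sw] [-> ->].
    rewrite /crosses /incident /edge_src /edge_tgt /= !label_nonroot /=.
    by rewrite Ss eqxx (negPf Sw) s_m mw.
  rewrite /crosses /incident /edge_src /edge_tgt /= !label_nonroot /=.
  by rewrite Ss eqxx (negPf Sw) s_m mw orbT.
rewrite /incident /crosses /edge_src /edge_tgt /= => /andP[/andP[uv cr]].
case/orP=> /eqP ls; move: cr uv; rewrite ls /= Ss (label_Some ls) => Sx uv.
  exists v; last by rewrite /F; case/andP: uv => /= ->.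
  by rewrite addTb in Sx; rewrite inE mem_nonroot Sx /adj !inE uv.
exists u; last by rewrite /F; case/andP: uv => /= _; rewrite ltnNge => ->.
rewrite inE mem_nonroot; move: Sx; rewrite addbT => ->.
by rewrite /adj !inE uv orbT.
Qed.

(** The exponents of the generator of the parking ideal attached to [S]. *)
Definition park_exponent S : 'X_{1..N} :=
  [multinom (if s \in S then out_degree S s else 0%N) | s < N].

Lemma park_monomialE S : park_monomial K S = 'X_[park_exponent S].
Proof.
rewrite /park_monomial mpolyXE_id big_mkcond; apply: eq_bigr => s _.
by rewrite mnmE; case: ifP; rewrite ?expr0.
Qed.

Lemma park_idealP f :
  f \in park_ideal K n m <->
  supported (unstable edge_src edge_tgt setT Kedges) f.
Proof.
split=> [/gen_idealP[q ->]|unst_f].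
  apply: supported_sum => S nzS; rewrite park_monomialE.
  apply: supportedM; first by move=> a b; apply: unstable_up.
  apply: supportedX; right; exists S; split; rewrite ?subsetT // => s Ss.
  by rewrite cut_degree_Kedges // mnmE Ss.
rewrite (mpolyE f) big_seq; apply: rpred_sum => a /unst_f.
case=> [[v]|[S [nzS _ leS]]]; first by rewrite inE.
have -> : 'X_[a] = 'X_[a - park_exponent S] * park_monomial K S.
  rewrite park_monomialE -mpolyXD submK //; apply/mnm_lepP=> s; rewrite mnmE.
  by case: ifP => // Ss; rewrite -cut_degree_Kedges ?leS.
by rewrite rpredZ //; apply: mem_gen_ideal.
Qed.

(** The substitution of 0 for the root variable. *)
Definition root0 : {mpoly K[m + n]} -> {mpoly K[N]} :=
  mmap (@mpolyC N K) (fun v => end_var K (label v)).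
HB.instance Definition _ := GRing.RMorphism.on root0.

Lemma root0C c : root0 c%:MP = c%:MP.
Proof. exact: mmapC. Qed.

Lemma root0X v : root0 'X_v = end_var K (label v).
Proof. by rewrite /root0 mmapX mmap1U. Qed.

Lemma root0Z c p : root0 (c *: p) = c *: root0 p.
Proof. by rewrite -!mul_mpolyC rmorphM /= root0C. Qed.

Lemma root0_subgraph_poly H :
  root0 (subgraph_poly K H) = edge_prod K edge_src edge_tgt H.
Proof.
by rewrite rmorph_prod; apply: eq_bigr => e _; rewrite rmorphB /= !root0X.
Qed.

(** Membership in the slim space, with the sum taken in the polynomial ring rather
    than in the representation. *)
Lemma slim_span_sum p : p \in slim_span K n m ->
  exists c : {set edge} -> K, p = \sum_(H | slim H) c H *: subgraph_poly K H.
Proof. by case/lin_spanP=> c pE; exists c; exact: pE. Qed.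

Lemma root0_slim p : p \in slim_span K n m ->
  root0 p \in lin_span (slim_in edge_src edge_tgt setT Kedges)
                       (edge_prod K edge_src edge_tgt).
Proof.
move=> /slim_span_sum[c ->]; rewrite rmorph_sum rpred_sum // => H slH.
by rewrite /= root0Z rpredZ // root0_subgraph_poly mem_lin_span // -slim_cutE.
Qed.

Lemma root0_slim_surj f :
  f \in lin_span (slim_in edge_src edge_tgt setT Kedges)
                 (edge_prod K edge_src edge_tgt) ->
  exists2 p, p \in slim_span K n m & root0 p = f.
Proof.
case/lin_spanP=> c ->.
exists (\sum_(H | slim_in edge_src edge_tgt setT Kedges H)
          c H *: subgraph_poly K H).
  by apply/lin_spanP; exists c; apply: eq_bigl => H; rewrite slim_cutE.
rewrite rmorph_sum; apply: eq_bigr => H _.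
by rewrite /= root0Z root0_subgraph_poly.
Qed.

(** The substitution of [x_s - x_v0] for [x_s]; with [v0] the root, it inverts
    [root0] on polynomials in differences of variables. *)
Definition recenter v0 : {mpoly K[N]} -> {mpoly K[m + n]} :=
  mmap (@mpolyC (m + n) K) (fun s => 'X_(nonroot s) - 'X_v0).
HB.instance Definition _ v0 := GRing.RMorphism.on (recenter v0).

Lemma recenter_end_var v0 v : label v0 = None ->
  recenter v0 (end_var K (label v)) = 'X_v - 'X_v0.
Proof.
move=> lv0; case lv: (label v) => [s|] /=.
  by rewrite /recenter mmapX mmap1U (label_Some lv).
by rewrite rmorph0 (label_inj (etrans lv (esym lv0))) subrr.
Qed.

Lemma root0K v0 p : label v0 = None -> p \in slim_span K n m ->
  recenter v0 (root0 p) = p.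
Proof.
move=> lv0 /slim_span_sum[c ->]; rewrite [root0 _]rmorph_sum [LHS]rmorph_sum.
apply: eq_bigr => H _; rewrite /= root0Z root0_subgraph_poly.
rewrite -!mul_mpolyC rmorphM [in RHS]/subgraph_poly; congr (_ * _).
  exact: mmapC.
rewrite rmorph_prod; apply: eq_bigr => e _.
by rewrite rmorphB /= !recenter_end_var // opprB addrA subrK.
Qed.

Lemma root0_slim_inj p : p \in slim_span K n m -> root0 p = 0 -> p = 0.
Proof.
have [v0 lv0] := root_exists => /(root0K lv0) {2}<- ->.
exact: rmorph0.
Qed.

Lemma label_vperm (g : 'S_n.-1 * 'S_m) v :
  label (vperm (pair_incl g) v) = omap (vperm g) (label v).
Proof.
case lv: (label v) => [s|] /=.
  by rewrite (label_Some lv) -vperm_nonroot label_nonroot.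
case lg: (label _) => [s|] //; move: (label_Some lg).
rewrite -(permKV (vperm g) s) vperm_nonroot => /perm_inj vE.
by rewrite vE label_nonroot in lv.
Qed.

Lemma root0_sym (g : 'S_n.-1 * 'S_m) p :
  root0 (msym (vperm (pair_incl g)) p) = msym (vperm g) (root0 p).
Proof.
rewrite -[LHS]/((root0 \o msym (vperm (pair_incl g))) p).
rewrite -[RHS]/((msym (vperm g) \o root0) p).
move: p; apply: mpoly_rmorph_ext => [c|v] /=.
  by rewrite /msym !root0C !mmapC root0C.
rewrite msymXi !root0X label_vperm; case: (label v) => [s|] /=.
  by rewrite msymXi.
by rewrite rmorph0.
Qed.

(** The isomorphism: the class of a slim polynomial with the root variable set to
    0. *)
Definition slim_to_park (u : submod (slim_span K n m)) :
    quotmod (park_ideal K n m) :=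
  quot_class (park_ideal K n m) (root0 (val u)).

Lemma slim_to_park_linear : linear slim_to_park.
Proof.
move=> c u v; rewrite /slim_to_park -quot_classZ -quot_classD.
by congr quot_class; rewrite -root0Z -rmorphD.
Qed.

Lemma slim_to_park_inj : injective slim_to_park.
Proof.
move=> u v /quot_class_eqP; rewrite -rmorphB => /park_idealP unst.
apply: val_inj; apply/eqP; rewrite -subr_eq0; apply/eqP.
have slim_uv : val u - val v \in slim_span K n m.
  exact: rpredB (valP u) (valP v).
apply: root0_slim_inj => //; move: unst.
apply: unstable_support_eq0 => [a _ v'|S nzS sST]; first by rewrite inE.
exact: size_shift_slim (root0_slim slim_uv).
Qed.

Lemma slim_to_park_surj y : exists u, slim_to_park u = y.
Proof.
have [q ->] := quot_classP y.
have [f /root0_slim_surj[p p_slim <-] unst] :=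
  slim_spans_quotient edge_src edge_tgt setT Kedges q.
exists (Submod p_slim); apply/esym/quot_class_eqP; exact/park_idealP.
Qed.

Lemma slim_to_park_act (u : Slim K n m) (g : 'S_n.-1 * 'S_m) :
  slim_to_park (rep_act (Slim K n m) u (pair_incl g)) =
  rep_act (Park K n m) (slim_to_park u) g.
Proof.
apply/esym; apply: etrans (quot_funE (@park_ideal_stable K n m) _ _) _.
by apply/esym; congr quot_class; apply: root0_sym.
Qed.

(** The isomorphism over an arbitrary field. *)
Theorem Slim_Park_iso :
  rep_iso (res_rep (incl_morphism n m) (Slim K n m)) (Park K n m).
Proof.
pose phi : {linear submod (slim_span K n m) -> quotmod (park_ideal K n m)} :=
  HB.pack slim_to_park (GRing.isLinear.Build _ _ _ _ _ slim_to_park_linear).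
exists phi; split.
  have [psi psiK] := boolp.choice slim_to_park_surj.
  by exists psi => // u; apply: slim_to_park_inj; rewrite psiK.
exact: slim_to_park_act.
Qed.
End CompleteBipartite.

Local Open Scope complex_scope.

Theorem theorem1p2 (R : realType) (n m : nat) :
  (1 <= n)%N -> (1 <= m)%N ->
  rep_iso (res_rep (incl_morphism n m) (Slim R[i] n m)) (Park R[i] n m).
Proof. by move=> n_gt0 _; apply: Slim_Park_iso. Qed.
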